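(* The function $A \mapsto |A|$ (with values in $[1,\infty]$) is lower semicontinuous with respect to Gromov--Hausdorff distance on the class of compact positive definite metric spaces.
   Context: Metric spaces are nonempty. For a finite metric space $(B,d)$, its similarity matrix is $\zeta_B \in \mathbb{R}^{B\times B}$, $\zeta_B(x,y)=e^{-d(x,y)}$; a metric space $A$ is positive definite if $\zeta_B$ is a positive definite matrix for every nonempty finite subset $B \subseteq A$ (with the induced metric). $M(A)$ is the space of finite signed Borel measures on $A$. For compact $(A,d)$, $Z_A(\mu,\nu) = \int_A\int_A e^{-d(x,y)}\,d\mu(x)\,d\nu(y)$ for $\mu,\nu\in M(A)$. The magnitude of a compact positive definite metric space $A$ is $|A| = \sup\{\mu(A)^2/Z_A(\mu,\mu) : \mu\in M(A),\ Z_A(\mu,\mu)\neq 0\}$. The Gromov--Hausdorff distance between metric spaces $A$ and $B$ is $d_{GH}(A,B) = \inf d_H(\varphi(A),\psi(B))$, the infimum over all metric spaces $X$ and isometric embeddings $\varphi:A\to X$, $\psi:B\to X$, where $d_H$ is the Hausdorff distance in $X$, $d_H(S,T) = \max\{\sup_{s\in S} d(s,T),\ \sup_{t\in T} d(t,S)\}$. *)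

(* Defs.v *)
From HB Require Import structures.
From mathcomp Require Import all_boot all_order all_algebra finmap.
From mathcomp Require Import all_classical all_reals all_analysis.

Set Implicit Arguments.
Unset Strict Implicit.
Unset Printing Implicit Defensive.

Import Order.TTheory GRing.Theory Num.Theory.
Import numFieldNormedType.Exports.

Local Open Scope classical_set_scope.
Local Open Scope ring_scope.

(* Nonempty metric spaces.  The distinguished point only witnesses nonemptiness
   (the library's measurable types are pointed); no definition below uses it. *)
#[short(type="pmetricType")]
HB.structure Definition PointedMetric (K : numDomainType) :=
  { M of Pointed M & Metric K M }.

Section positive_definite.
Context {R : realType}.

Definition posdefmx n (M : 'M[R]_n) : Prop :=
  M^T = M /\ forall v : 'rV[R]_n, v != 0 -> 0 < (v *m M *m v^T) 0 0.

(* Rows and columns are indexed by the enumeration of the finite type of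
   elements of B. *)
Definition similarity_mx (A : metricType R) (B : {fset A}) :
    'M[R]_#|{: B}| :=
  \matrix_(i, j) expR (- mdist (val (enum_val i) : A) (val (enum_val j))).

Definition positive_definite (A : metricType R) : Prop :=
  forall B : {fset A}, B != fset0 -> posdefmx (similarity_mx B).

End positive_definite.

Section charge_integral.
Context d (T : measurableType d) (R : realType).
Implicit Type nu : {charge set T -> \bar R}.

Definition hahn_pos nu : set T := sval (cid (Hahn_decomposition nu)).

Definition hahn_neg nu : set T := sval (cid (svalP (cid (Hahn_decomposition nu)))).

Lemma hahn_pos_neg nu : hahn_decomposition nu (hahn_pos nu) (hahn_neg nu).
Proof. exact: svalP (cid (svalP (cid (Hahn_decomposition nu)))). Qed.

(* The Jordan decomposition does not depend on the chosen Hahn decomposition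
   (Hahn_decomposition_uniq).  Meant for f integrable with respect to both
   parts, e.g. f bounded and measurable. *)
Definition charge_integral nu (f : T -> R) : R :=
  Rintegral (jordan_pos (hahn_pos_neg nu)) setT f
  - Rintegral (jordan_neg (hahn_pos_neg nu)) setT f.

End charge_integral.

Section magnitude.
Context {R : realType}.

Definition borelType (A : pmetricType R) := g_sigma_algebraType (@open A).

Definition similarity_form (A : pmetricType R)
    (mu nu : {charge set (borelType A) -> \bar R}) : R :=
  charge_integral nu (fun y : A =>
    charge_integral mu (fun x : A => expR (- mdist x y))).

Definition magnitude (A : pmetricType R) : \bar R :=
  ereal_sup [set (fine (mu setT) ^+ 2 / similarity_form mu mu)%:E |
    mu in [set mu : {charge set (borelType A) -> \bar R} |
           similarity_form mu mu != 0]].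

End magnitude.

Section gromov_hausdorff.
Context {R : realType}.
Local Open Scope ereal_scope.

Definition dist_to_set (X : metricType R) (x : X) (S : set X) : \bar R :=
  ereal_inf [set (mdist x y)%:E | y in S].

Definition hausdorff_dist (X : metricType R) (S T : set X) : \bar R :=
  maxe (ereal_sup [set dist_to_set s T | s in S])
       (ereal_sup [set dist_to_set t S | t in T]).

Definition isometric_embedding (A X : metricType R) (phi : A -> X) : Prop :=
  forall x y, mdist (phi x) (phi y) = mdist x y.

Definition gh_dist (A B : metricType R) : \bar R :=
  ereal_inf [set r | exists (X : metricType R) (phi : A -> X) (psi : B -> X),
    [/\ isometric_embedding phi, isometric_embedding psi
      & r = hausdorff_dist (range phi) (range psi)]].

(* Lower semicontinuity, in the form of lower_semicontinuous, of the restriction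
   of F to the class C with the topology of the pseudometric gh_dist. *)
Definition gh_lower_semicontinuous_on (C : pmetricType R -> Prop)
    (F : pmetricType R -> \bar R) : Prop :=
  forall A : pmetricType R, C A -> forall a : R, a%:E < F A ->
    exists2 e : R, (0 < e)%R &
      forall B : pmetricType R, C B -> gh_dist A B < e%:E -> a%:E < F B.

End gromov_hausdorff.

Definition compact_positive_definite (R : realType) (A : pmetricType R) : Prop :=
  compact [set: A] /\ positive_definite A.

(* Main.v *)
Require Import Defs.
From HB Require Import structures.
From mathcomp Require Import all_boot all_order all_algebra finmap.
From mathcomp Require Import all_classical all_reals all_analysis.
From mathcomp Require Import measurable_realfun.
From mathcomp Require Import ring lra.

Set Implicit Arguments.
Unset Strict Implicit.
Unset Printing Implicit Defensive.

Import Order.TTheory GRing.Theory Num.Theory.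
Import numFieldNormedType.Exports.

Local Open Scope classical_set_scope.
Local Open Scope ring_scope.

(** The magnitude is a supremum of quotients mu(A)^2 / Z_A(mu, mu), and a
    supremum of continuous functions is lower semicontinuous; a signed measure
    on A does not act on another space B, but once it is replaced by a finitely
    supported one its quotient can be compared with that of a measure on B.

    Let mu be a signed measure on A whose quotient exceeds a, and let m be its
    total variation.  Cut A into finitely many Borel pieces, the i-th one lying
    within e of a point t_i ([finite_quantization]; this is total boundedness of
    a compact space), and move the mass w_i of each piece to t_i.  The total mass
    is unchanged, and since exp(-d) is 1-Lipschitz in each variable the form
    Z_A(mu, mu) changes by at most 2 e m^2 ([similarity_form_quantization]).  If
    B is at Gromov-Hausdorff distance less than e from A, choose points g(t_i) in
    B that are e-close to the t_i in a common ambient space.  Distances change by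
    at most 2 e, so moving the masses w_i to the points g(t_i) changes the form by
    at most a further 2 e m^2 ([gh_dist_close], [weighted_form_dist]).  As
    Q |-> mu(A)^2 / Q is continuous at Z_A(mu, mu) <> 0, for e small the measure
    on B with masses w_i at g(t_i) still has quotient larger than a, so the
    magnitude of B exceeds a ([magnitude_ge_weighted]).

    The bound 1 <= |A| is the quotient of a point mass.

    Integrals against a signed measure are handled through one estimate,
    [charge_integral_quantization_error]: an integral is close to its Riemann sum
    over a fine partition.  It serves both for discretizing mu and for computing
    integrals against a finitely supported measure. *)

(** * Integration of bounded functions against a signed measure *)

Section charge_integral_theory.
Context d (T : measurableType d) (R : realType).
Implicit Types (nu : {charge set T -> \bar R}) (f g : T -> R).

Definition bounded_measurable f :=
  measurable_fun setT f /\ exists M, forall x, `|f x| <= M.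

Lemma bounded_measurable_integrable (m : {finite_measure set T -> \bar R}) f :
  bounded_measurable f -> m.-integrable setT (EFin \o f).
Proof.
move=> [mf [M fM]]; apply: measurable_bounded_integrable => //.
  by rewrite ltey_eq fin_num_measure.
exists M; split; first exact: num_real.
by move=> N MN x _; exact: le_trans (fM x) (ltW MN).
Qed.

Lemma bounded_measurable_cst (c : R) : bounded_measurable (cst c).
Proof. by split; [exact: measurable_cst|exists `|c|]. Qed.

Lemma bounded_measurable_indic (D : set T) :
  measurable D -> bounded_measurable (\1_D).
Proof.
move=> mD; split; first exact: measurable_indic.
by exists 1 => x; rewrite indicE ger0_norm// lern1 leq_b1.
Qed.

Lemma bounded_measurableD f g : bounded_measurable f -> bounded_measurable g ->
  bounded_measurable (fun x => f x + g x).
Proof.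
move=> [mf [M fM]] [mg [N gN]]; split; first exact: measurable_funD.
by exists (M + N) => x; rewrite (le_trans (ler_normD _ _))// lerD.
Qed.

Lemma bounded_measurableZ (c : R) f : bounded_measurable f ->
  bounded_measurable (fun x => c * f x).
Proof.
move=> [mf [M fM]]; split; first exact: measurable_funM.
by exists (`|c| * M) => x; rewrite normrM ler_wpM2l.
Qed.

Lemma bounded_measurableB f g : bounded_measurable f -> bounded_measurable g ->
  bounded_measurable (fun x => f x - g x).
Proof.
move=> [mf [M fM]] [mg [N gN]]; split; first exact: measurable_funB.
by exists (M + N) => x; rewrite (le_trans (ler_normB _ _))// lerD.
Qed.

Lemma bounded_measurable_sum (I : Type) (s : seq I) (F : I -> T -> R) :
  (forall i, bounded_measurable (F i)) ->
  bounded_measurable (fun x => \sum_(i <- s) F i x).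
Proof.
move=> bF; elim: s => [|i s ih].
  under eq_fun do rewrite big_nil; exact: bounded_measurable_cst.
by under eq_fun do rewrite big_cons; exact: bounded_measurableD.
Qed.

Lemma charge_integralD nu f g : bounded_measurable f -> bounded_measurable g ->
  charge_integral nu (fun x => f x + g x) =
  charge_integral nu f + charge_integral nu g.
Proof.
move=> bf bg; rewrite /charge_integral !RintegralD//;
  try exact: bounded_measurable_integrable.
by ring.
Qed.

Lemma charge_integralB nu f g : bounded_measurable f -> bounded_measurable g ->
  charge_integral nu (fun x => f x - g x) =
  charge_integral nu f - charge_integral nu g.
Proof.
move=> bf bg; rewrite /charge_integral !RintegralB//;
  try exact: bounded_measurable_integrable.
by ring.
Qed.

Lemma charge_integralZ nu (c : R) f : bounded_measurable f ->
  charge_integral nu (fun x => c * f x) = c * charge_integral nu f.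
Proof.
move=> bf; rewrite /charge_integral !RintegralZl//;
  try exact: bounded_measurable_integrable.
by ring.
Qed.

Lemma charge_integral_indic nu (D : set T) : measurable D ->
  charge_integral nu \1_D = fine (nu D).
Proof.
move=> mD; rewrite /charge_integral /Rintegral !integral_indic// setIT.
rewrite (jordan_decomp (hahn_pos_neg nu) mD) /cadd/= cscaleN1.
by rewrite fineB// fin_num_measure.
Qed.

Lemma charge_integral_sum nu (I : Type) (s : seq I) (F : I -> T -> R) :
  (forall i, bounded_measurable (F i)) ->
  charge_integral nu (fun x => \sum_(i <- s) F i x) =
  \sum_(i <- s) charge_integral nu (F i).
Proof.
move=> bF; elim: s => [|i s ih].
  under [in LHS]eq_fun do rewrite big_nil.
  by rewrite big_nil /charge_integral !Rintegral_cst// !mul0r subrr.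
under [in LHS]eq_fun do rewrite big_cons.
rewrite charge_integralD//; last exact: bounded_measurable_sum.
by rewrite ih big_cons.
Qed.

(** The total variation of [nu]. *)
Definition charge_mass nu : R :=
  fine (jordan_pos (hahn_pos_neg nu) setT) +
  fine (jordan_neg (hahn_pos_neg nu) setT).

Lemma charge_mass_ge0 nu : 0 <= charge_mass nu.
Proof. by rewrite addr_ge0 ?fine_ge0. Qed.

Lemma norm_charge_integral_le nu f (c : R) : bounded_measurable f ->
  (forall x, `|f x| <= c) -> `|charge_integral nu f| <= c * charge_mass nu.
Proof.
move=> bf fc.
have bound (m : {finite_measure set T -> \bar R}) :
    `|Rintegral m setT f| <= c * fine (m setT).
  rewrite -Rintegral_cst//.
  apply: le_trans (le_normr_Rintegral _ _) _ => //.
    exact: bounded_measurable_integrable.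
  apply: le_Rintegral => //; apply: bounded_measurable_integrable.
    case: bf => mf [M fM]; split; first exact: measurableT_comp.
    by exists M => x; rewrite normr_id.
  exact: bounded_measurable_cst.
by rewrite mulrDr (le_trans (ler_normB _ _))// lerD//; exact: bound.
Qed.

(** * Riemann sums over a finite measurable partition *)

(** A finite measurable partition is given by the map [p] sending a point to the
    index of its piece, so that a function constant on each piece has the form
    [c \o p]; disjointness and covering then hold by construction. *)
Section quantization.
Variables (nu : {charge set T -> \bar R}) (n : nat) (p : T -> 'I_n).
Hypothesis mp : forall i, measurable (p @^-1` [set i]).

Lemma sum_indic_fibers (c : 'I_n -> R) x :
  \sum_(i < n) c i * \1_(p @^-1` [set i]) x = c (p x).
Proof.
rewrite (bigD1 (p x))//= indicE mem_set// mulr1 big1 ?addr0// => i ipx.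
by rewrite indicE memNset ?mulr0//= => pxi; rewrite pxi eqxx in ipx.
Qed.

Lemma bounded_measurable_quantized (c : 'I_n -> R) :
  bounded_measurable (fun x => c (p x)).
Proof.
under eq_fun do rewrite -sum_indic_fibers.
apply: bounded_measurable_sum => i; apply: bounded_measurableZ.
exact: bounded_measurable_indic.
Qed.

Lemma charge_integral_quantized (c : 'I_n -> R) :
  charge_integral nu (fun x => c (p x)) =
  \sum_(i < n) c i * fine (nu (p @^-1` [set i])).
Proof.
under eq_fun do rewrite -sum_indic_fibers.
rewrite charge_integral_sum => [|i]; last first.
  by apply: bounded_measurableZ; exact: bounded_measurable_indic.
apply: eq_bigr => i _; rewrite charge_integralZ ?charge_integral_indic//.
exact: bounded_measurable_indic.
Qed.

Lemma sum_fibers : \sum_(i < n) fine (nu (p @^-1` [set i])) = fine (nu setT).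
Proof.
have := charge_integral_quantized (fun=> 1).
under eq_bigr do rewrite mul1r.
by move=> <-; rewrite -charge_integral_indic// indicT.
Qed.

(** The sum of the absolute masses is the integral of the sign of the mass of the
    piece, a function bounded by 1. *)
Lemma sum_normr_fibers :
  \sum_(i < n) `|fine (nu (p @^-1` [set i]))| <= charge_mass nu.
Proof.
pose s i : R := Num.sg (fine (nu (p @^-1` [set i]))).
have -> : \sum_(i < n) `|fine (nu (p @^-1` [set i]))| =
    charge_integral nu (fun x => s (p x)).
  by rewrite charge_integral_quantized; apply: eq_bigr => i _; rewrite normrEsg.
rewrite (le_trans (ler_norm _))// -[leRHS]mul1r norm_charge_integral_le//.
  exact: bounded_measurable_quantized.
by move=> x; rewrite normr_sg lern1 leq_b1.
Qed.

(** [f] is within [e] of the function [c \o p], whose integral is the Riemann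
    sum. *)
Lemma charge_integral_quantization_error f (c : 'I_n -> R) (e : R) :
  measurable_fun setT f -> (forall x, `|f x - c (p x)| <= e) ->
  `|charge_integral nu f - \sum_(i < n) c i * fine (nu (p @^-1` [set i]))| <=
  e * charge_mass nu.
Proof.
move=> mf fc; have [_ [M cM]] := bounded_measurable_quantized c.
have bf : bounded_measurable f.
  split=> //; exists (e + M) => x; rewrite -[f x](subrK (c (p x))).
  by rewrite (le_trans (ler_normD _ _))// lerD.
rewrite -charge_integral_quantized -charge_integralB//; last first.
  exact: bounded_measurable_quantized.
apply: norm_charge_integral_le => //; apply: bounded_measurableB => //.
exact: bounded_measurable_quantized.
Qed.

End quantization.

Lemma finitely_supported_charge n (w : 'I_n -> R) (y : 'I_n -> T) :
  exists nu : {charge set T -> \bar R}, forall D, measurable D ->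
    nu D = (\sum_(i < n) w i * \1_D (y i))%:E.
Proof.
elim: n w y => [|n ih] w y.
  by exists czero => D mD; rewrite big_ord0.
have [nu nuE] := ih (w \o lift ord0) (y \o lift ord0).
exists (cadd (cscale (w ord0) (charge_of_finite_measure (dirac (y ord0)))) nu).
by move=> D mD; rewrite big_ord_recl EFinD EFinM -[X in (_ + X)%E](nuE D mD).
Qed.

End charge_integral_theory.

(** * The kernel exp(-d) and discrete similarity forms *)

Section kernel.
Context {R : realType}.

(** For [a <= b], factor out [expR (- a) <= 1] and use [1 + x <= expR x] at
    [x = a - b]. *)
Lemma dist_expRN_le (a b : R) : 0 <= a -> 0 <= b ->
  `|expR (- a) - expR (- b)| <= `|a - b|.
Proof.
wlog ab : a b / a <= b => [wl a0 b0|a0 b0].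
  by have [/wl->//|/ltW/wl] := leP a b; rewrite distrC (distrC b); exact.
have -> : expR (- a) - expR (- b) = expR (- a) * (1 - expR (a - b)).
  by rewrite mulrBr mulr1 -expRD addrA addNr add0r.
have h1 : expR (a - b) <= 1 by rewrite -expR0 ler_expR subr_le0.
rewrite normrM ger0_norm ?expR_ge0// ger0_norm ?subr_ge0// distrC.
rewrite (@ger0_norm _ (b - a)) ?subr_ge0//.
apply: (@le_trans _ _ (1 * (1 - expR (a - b)))).
  by rewrite ler_wpM2r ?subr_ge0// -expR0 ler_expR oppr_le0.
by have := expR_ge1Dx (a - b); rewrite mul1r => h; lra.
Qed.

(** The value of the bilinear form with kernel [k] on the measure with masses
    [w], written as an iterated sum in the order of the iterated integral that
    defines the similarity form. *)
Definition weighted_form n (w : 'I_n -> R) (k : 'I_n -> 'I_n -> R) : R :=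
  \sum_(j < n) (\sum_(i < n) k i j * w i) * w j.

Lemma weighted_form_dist n (w : 'I_n -> R) (k l : 'I_n -> 'I_n -> R) (e : R) :
  (forall i j, `|k i j - l i j| <= e) ->
  `|weighted_form w k - weighted_form w l| <= e * (\sum_(i < n) `|w i|) ^+ 2.
Proof.
move=> kl; rewrite /weighted_form -sumrB (le_trans (ler_norm_sum _ _ _))//.
rewrite expr2 mulrA mulr_sumr ler_sum// => j _.
rewrite -mulrBl normrM ler_wpM2r//.
rewrite -sumrB (le_trans (ler_norm_sum _ _ _))// mulr_sumr ler_sum// => i _.
by rewrite -mulrBl normrM ler_wpM2r.
Qed.

Variable A : metricType R.
Implicit Types x y z : A.

Lemma mdist_lipschitz x y z : `|mdist x y - mdist x z| <= mdist y z.
Proof.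
rewrite ler_norml; apply/andP; split.
  by have := metric_triangle x y z; lra.
by have := metric_triangle x z y; rewrite (metric_sym z y); lra.
Qed.

Lemma expR_mdist_lipschitz x y z :
  `|expR (- mdist x y) - expR (- mdist x z)| <= mdist y z.
Proof.
apply: le_trans (mdist_lipschitz x y z).
by apply: dist_expRN_le; exact: mdist_ge0.
Qed.

End kernel.

(** * Discretization on compact metric spaces *)

Section borel.
Context {R : realType} (A : pmetricType R).
Local Notation BA := (borelType A).
Implicit Type mu : {charge set BA -> \bar R}.

Lemma open_measurable_borel (D : set A) : open D -> measurable (D : set BA).
Proof. exact: sub_sigma_algebra. Qed.

Lemma open_mdist_ball (x : A) (e : R) : open (ball x e).
Proof.
rewrite openE => y /=; rewrite ballEmdist /= => xy.
apply/nbhs_ballP; exists (e - mdist x y); rewrite /= ?subr_gt0// => z.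
rewrite !ballEmdist/= => yz; have := metric_triangle x y z; lra.
Qed.

Lemma lipschitz_measurable (L : R) (f : A -> R) :
  (forall x y, `|f x - f y| <= L * mdist x y) ->
  measurable_fun setT (f : BA -> R).
Proof.
move=> fL; have cf : continuous f.
  move=> x; apply/cvgrPdist_lt => e e0.
  have d0 : 0 < e / (`|L| + 1) by rewrite divr_gt0// ltr_wpDl.
  apply/nbhs_ballP; exists (e / (`|L| + 1)) => //= y; rewrite ballEmdist/= => xy.
  rewrite (le_lt_trans (fL x y))//.
  rewrite ltr_pdivlMr ?ltr_wpDl// in xy.
  have := ler_norm L; have := mdist_ge0 x y; nra.
apply: (measurability _ (RGenOpens.measurableE R)).
move=> _ [_ [a [b ->] <-]]; rewrite setTI; apply: open_measurable_borel.
by move/continuousP : cf; apply; exact: interval_open.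
Qed.

(** By compactness finitely many balls of radius [e] cover the space.  Send a point
    to the first of these balls that contains it: the fibers are differences of
    open sets. *)
Lemma finite_quantization (e : R) : compact [set: A] -> 0 < e ->
  exists n (t : 'I_n -> A) (p : BA -> 'I_n),
    (forall i, measurable (p @^-1` [set i])) /\
    (forall x, mdist (t (p x)) x < e).
Proof.
rewrite compact_cover => cA e0.
have [i _||X _ XA] := cA A setT (fun x => ball x e).
- exact: open_mdist_ball.
- by move=> x _; exists x => //; exact: ballxx.
pose t (i : 'I_(size (enum_fset X))) : A := nth point (enum_fset X) i.
pose first x i :=
  ball (t i) e x /\ forall j, (val j < val i)%N -> ~ ball (t j) e x.
have exfirst x : exists i, first x i.
  have [y /= Xy xy] := XA x I.
  have iy : (index y (enum_fset X) < size (enum_fset X))%N by rewrite index_mem.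
  have Py : `[< ball (t (Ordinal iy)) e x >].
    by apply/asboolP; rewrite /t nth_index.
  have [i /asboolP xi imin] :=
    @arg_minnP _ _ (fun i => `[< ball (t i) e x >]) val Py.
  by exists i; split=> // j ji /asboolP/imin; rewrite leqNgt ji.
have [p pP] := choice exfirst.
exists _, t, p; split=> [i|x]; last by have [] := pP x; rewrite ballEmdist.
rewrite (_ : _ @^-1` _ = ball (t i) e `&`
    \bigcap_(j in [set j | (val j < val i)%N]) ~` ball (t j) e).
  apply: measurableI.
    by apply: open_measurable_borel; exact: open_mdist_ball.
  apply: fin_bigcap_measurable => [|j _]; first exact: finite_finset.
  apply: measurableC.
  by apply: open_measurable_borel; exact: open_mdist_ball.
apply/seteqP; split => x /=; first by move=> <-; exact: pP.
move=> [xi xj]; have [xp xl] := pP x; apply/val_inj/eqP.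
rewrite eqn_leq leqNgt [X in _ && X]leqNgt; apply/andP; split; apply/negP.
  by move=> /xl.
by move=> /xj.
Qed.

Lemma expR_mdist_bounded_measurable (y : A) :
  bounded_measurable (fun x : BA => expR (- mdist (x : A) y)).
Proof.
split; last first.
  exists 1 => x; rewrite ger0_norm ?expR_ge0// -expR0 ler_expR oppr_le0.
  exact: mdist_ge0.
apply: (@lipschitz_measurable 1) => x z; rewrite mul1r.
by rewrite (metric_sym x y) (metric_sym z y); exact: expR_mdist_lipschitz.
Qed.

Definition potential mu (y : A) : R :=
  charge_integral mu (fun x : A => expR (- mdist x y)).

(** This makes the inner integral of the similarity form measurable, so that the
    outer one obeys the estimates for Riemann sums. *)
Lemma potential_lipschitz mu (y z : A) :
  `|potential mu y - potential mu z| <= charge_mass mu * mdist y z.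
Proof.
rewrite /potential -charge_integralB; [|exact: expR_mdist_bounded_measurable..].
rewrite mulrC; apply: norm_charge_integral_le => [|x].
  by apply: bounded_measurableB; exact: expR_mdist_bounded_measurable.
exact: expR_mdist_lipschitz.
Qed.

(** Discretize the outer integral, whose integrand is Lipschitz with constant the
    total variation, and then each of the inner ones; either step costs [e] times
    the square of the total variation. *)
Lemma similarity_form_quantization mu n (t : 'I_n -> A) (p : BA -> 'I_n) (e : R) :
  (forall i, measurable (p @^-1` [set i])) ->
  (forall x, mdist (t (p x)) x <= e) ->
  `|similarity_form mu mu - weighted_form
      (fun i => fine (mu (p @^-1` [set i])))
      (fun i j => expR (- mdist (t i) (t j)))| <= 2 * e * charge_mass mu ^+ 2.
Proof.
move=> mp pt; set w := fun i => fine (mu _); set m := charge_mass mu.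
have wm : \sum_(i < n) `|w i| <= m by exact: sum_normr_fibers.
have m0 : 0 <= m by exact: charge_mass_ge0.
have outer : `|similarity_form mu mu - \sum_(j < n) potential mu (t j) * w j|
    <= m * e * m.
  apply: charge_integral_quantization_error => // [|x].
    by apply: (@lipschitz_measurable m) => x y; exact: potential_lipschitz.
  rewrite (le_trans (potential_lipschitz _ _ _))// ler_wpM2l// metric_sym.
  exact: pt.
have inner j : `|potential mu (t j) -
    \sum_(i < n) expR (- mdist (t i) (t j)) * w i| <= e * m.
  apply: charge_integral_quantization_error => // [|x].
    by have [] := expR_mdist_bounded_measurable (t j).
  rewrite (le_trans _ (pt x))// (metric_sym x (t j)) (metric_sym _ (t j)).
  by rewrite (metric_sym (t (p x))); exact: expR_mdist_lipschitz.
have middle : `|\sum_(j < n) potential mu (t j) * w j -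
    weighted_form w (fun i j => expR (- mdist (t i) (t j)))| <= e * m * m.
  rewrite /weighted_form -sumrB (le_trans (ler_norm_sum _ _ _))//.
  have e0 : 0 <= e * m by rewrite mulr_ge0// (le_trans _ (pt point))// mdist_ge0.
  apply: (@le_trans _ _ (\sum_(j < n) e * m * `|w j|)).
    by apply: ler_sum => j _; rewrite -mulrBl normrM ler_wpM2r.
  by rewrite -mulr_sumr ler_wpM2l.
apply: le_trans (ler_distD _ _ _) (le_trans (lerD outer middle) _).
by rewrite le_eqVlt; apply/orP; left; apply/eqP; ring.
Qed.

Section finitely_supported.
Hypothesis cA : compact [set: A].
Variables (n : nat) (w : 'I_n -> R) (y : 'I_n -> A).
Variable nu : {charge set BA -> \bar R}.
Hypothesis nuE : forall D : set BA, measurable D ->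
  nu D = (\sum_(i < n) w i * \1_D (y i))%:E.

(** The Riemann sum of [f] over a partition of mesh [e] equals the sum of the
    [f (t (p (y i))) * w i], and [t (p (y i))] is [e]-close to [y i].  So the
    Riemann sum is within a fixed multiple of [e] of both sides, for all [e > 0]. *)
Lemma charge_integral_finitely_supported (L : R) (f : A -> R) : 0 <= L ->
  (forall x z, `|f x - f z| <= L * mdist x z) ->
  charge_integral nu f = \sum_(i < n) f (y i) * w i.
Proof.
move=> L0 fL; apply/eqP; rewrite -subr_eq0 -normr_le0.
set m := charge_mass nu; set W := \sum_(i < n) `|w i|.
have LW0 : 0 <= L * (m + W).
  by rewrite mulr_ge0// addr_ge0 ?charge_mass_ge0// sumr_ge0.
suff err e : 0 < e -> `|charge_integral nu f - \sum_(i < n) f (y i) * w i| <=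
    e * (L * (m + W)).
  apply/ler_addgt0Pl => e e0; rewrite addr0.
  have e1 : 0 < e / (L * (m + W) + 1) by rewrite divr_gt0// ltr_wpDl.
  rewrite (le_trans (err _ e1))// mulrAC ler_pdivrMr ?ltr_wpDl//.
  by apply: ler_wpM2l; [exact: ltW|rewrite lerDl].
move=> e0; have [k [t [p [mp pt]]]] := finite_quantization cA e0.
have sumE : \sum_(j < k) f (t j) * fine (nu (p @^-1` [set j])) =
    \sum_(i < n) f (t (p (y i))) * w i.
  under eq_bigr do rewrite nuE// mulr_sumr.
  rewrite exchange_big/=; apply: eq_bigr => i _.
  rewrite -(sum_indic_fibers p (fun j => f (t j)) (y i)) mulr_suml.
  by apply: eq_bigr => j _; ring.
have near x : `|f x - f (t (p x))| <= L * e.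
  by rewrite (le_trans (fL _ _))// ler_wpM2l// metric_sym ltW.
have e1 : `|charge_integral nu f - \sum_(i < n) f (t (p (y i))) * w i| <=
    L * e * m.
  rewrite -sumE; apply: charge_integral_quantization_error => //.
  exact: lipschitz_measurable fL.
have e2 : `|\sum_(i < n) f (t (p (y i))) * w i - \sum_(i < n) f (y i) * w i| <=
    L * e * W.
  rewrite -sumrB (le_trans (ler_norm_sum _ _ _))// mulr_sumr ler_sum// => i _.
  by rewrite -mulrBl normrM ler_wpM2r// distrC.
apply: le_trans (ler_distD _ _ _) (le_trans (lerD e1 e2) _).
by rewrite le_eqVlt; apply/orP; left; apply/eqP; ring.
Qed.

Lemma similarity_form_finitely_supported :
  similarity_form nu nu = weighted_form w (fun i j => expR (- mdist (y i) (y j))).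
Proof.
rewrite [LHS](charge_integral_finitely_supported (charge_mass_ge0 nu)).
  apply: eq_bigr => j _; congr (_ * _).
  apply: (charge_integral_finitely_supported ler01) => x z.
  rewrite mul1r (metric_sym x (y j)) (metric_sym z (y j)).
  exact: expR_mdist_lipschitz.
by move=> x z; exact: potential_lipschitz.
Qed.

End finitely_supported.

Lemma magnitude_ge_weighted n (w : 'I_n -> R) (y : 'I_n -> A) :
  compact [set: A] ->
  let Q := weighted_form w (fun i j => expR (- mdist (y i) (y j))) in
  Q != 0 -> (((\sum_(i < n) w i) ^+ 2 / Q)%:E <= magnitude A)%E.
Proof.
move=> cA Q Q0.
have [nu nuE] := finitely_supported_charge w (y : 'I_n -> BA).
have nuQ : similarity_form nu nu = Q by exact: similarity_form_finitely_supported.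
apply: ereal_sup_ubound; exists nu; rewrite /= nuQ//.
congr (_ ^+ 2 / _)%:E; rewrite nuE//=; apply: eq_bigr => i _.
by rewrite indicT mulr1.
Qed.

End borel.

(** * Gromov-Hausdorff approximation and semicontinuity *)

Lemma lt_div_near (R : realType) (W a Z : R) : Z != 0 -> a < W / Z ->
  exists2 e : R, 0 < e & forall Q, `|Z - Q| < e -> Q != 0 /\ a < W / Q.
Proof.
move=> Z0 aWZ.
have cdiv : (fun Q => W / Q) @ Z --> W / Z.
  by apply: cvgM; [exact: cvg_cst|exact: cvgV].
have /nbhs_ballP[e e0 eP] : \forall Q \near Z, Q != 0 /\ a < W / Q.
  near=> Q; split.
    by near: Q; exact: (cvgr_neq0 _ (@cvg_id _ (nbhs Z))).
  by near: Q; exact: cvgr_gt cdiv _ aWZ.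
by exists e => // Q ZQ; exact: eP.
Unshelve. all: by end_near. Qed.

(** In an ambient space realizing a Hausdorff distance less than [e], send each
    point of [A] to some [e]-close point of [B]; the triangle inequality bounds the
    distortion. *)
Lemma gh_dist_close (R : realType) (A B : metricType R) (e : R) :
  (gh_dist A B < e%:E)%E -> exists g : A -> B, forall x y,
    `|mdist x y - mdist (g x) (g y)| <= 2 * e.
Proof.
move=> /ereal_inf_lt[_ [X [phi [psi [iphi ipsi ->]]]]].
rewrite /hausdorff_dist gt_max => /andP[He _].
have near x : exists b, mdist (phi x) (psi b) < e.
  have : (dist_to_set (phi x) (range psi) < e%:E)%E.
    apply: le_lt_trans He; apply: ereal_sup_ubound.
    by exists (phi x) => //; exists x.
  by move=> /ereal_inf_lt[_ [_ [b _ <-] <-]]; rewrite lte_fin; exists b.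
have [g gP] := choice near; exists g => x y.
rewrite -iphi -ipsi.
have := gP x; have := gP y.
have := metric_triangle (phi x) (psi (g x)) (phi y).
have := metric_triangle (psi (g x)) (psi (g y)) (phi y).
have := metric_triangle (psi (g x)) (phi x) (psi (g y)).
have := metric_triangle (phi x) (phi y) (psi (g y)).
rewrite (metric_sym (psi (g x)) (phi x)) (metric_sym (psi (g y)) (phi y)).
by move=> *; rewrite ler_norml; apply/andP; split; lra.
Qed.

Theorem theorem2p6 (R : realType) :
  (forall A : pmetricType R, compact_positive_definite A ->
     (1%:E <= magnitude A)%E) /\
  gh_lower_semicontinuous_on (@compact_positive_definite R) (@magnitude R).
Proof.
split=> [A [cA _]|A [cA _] a].
  (* a single unit mass *)
  have := @magnitude_ge_weighted R A 1 (fun=> 1) (fun=> point) cA.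
  rewrite /weighted_form !big_ord1 mdistxx oppr0 expR0 !mulr1 divr1 expr1n.
  by apply; exact: oner_neq0.
move=> /ereal_sup_gt[_ [mu /= Z0 <-]]; rewrite lte_fin => aZ.
have [eta eta0 etaP] := lt_div_near Z0 aZ.
(* The two comparisons cost [2 * e * m ^+ 2] each; adding 1 to the denominator
   makes the total strictly less than [eta], and covers the case [m = 0]. *)
set m := charge_mass mu; pose e := eta / (4 * m ^+ 2 + 1).
have m0 : 0 <= m by exact: charge_mass_ge0.
have d0 : 0 < 4 * m ^+ 2 + 1 by rewrite ltr_wpDl// mulr_ge0// sqr_ge0.
have e0 : 0 < e by rewrite divr_gt0.
have em : 4 * e * m ^+ 2 < eta.
  rewrite /e -mulrA (mulrC _ (m ^+ 2)) mulrA mulrA ltr_pdivrMr// mulrC.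
  by rewrite ltr_pM2l// ltrDl.
exists e => // B [cB _] /gh_dist_close[g gP].
have [n [t [p [mp pt]]]] := finite_quantization cA e0.
pose w i : R := fine (mu (p @^-1` [set i])).
pose Q := weighted_form w (fun i j => expR (- mdist (g (t i)) (g (t j)))).
have ZQ : `|similarity_form mu mu - Q| < eta.
  apply: le_lt_trans em.
  pose QA := weighted_form w (fun i j => expR (- mdist (t i) (t j))).
  have e1 : `|similarity_form mu mu - QA| <= 2 * e * m ^+ 2.
    by apply: similarity_form_quantization => // x; exact: ltW.
  have e2 : `|QA - Q| <= 2 * e * (\sum_(i < n) `|w i|) ^+ 2.
    apply: weighted_form_dist => i j; apply: le_trans (gP _ _).
    by apply: dist_expRN_le; exact: mdist_ge0.
  have wm : (\sum_(i < n) `|w i|) ^+ 2 <= m ^+ 2.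
    by rewrite ler_sqr ?nnegrE ?sumr_ge0//; exact: sum_normr_fibers.
  rewrite (le_trans (ler_distD QA _ _))//.
  have := ler_wpM2l (ltW e0) wm; lra.
have [Q0 aQ] := etaP _ ZQ.
apply: lt_le_trans (magnitude_ge_weighted cB Q0).
by rewrite lte_fin sum_fibers.
Qed.
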